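(* Let $q\geq3$ and let $y$ be a vertex of the Farey graph $\mathcal{F}_q$. Vertices $v_1,\dots,v_n$ of $\mathcal{F}_q$ with $v_n=y$ are the consecutive convergents of some Rosen continued fraction $[b_1,\dots,b_n]_q$ with value $y$ if and only if $\langle\infty,v_1,\dots,v_n\rangle$ is a path in $\mathcal{F}_q$ (that is, $\infty\sim v_1$ and $v_{i-1}\sim v_i$ for $i=2,\dots,n$).
   Context: Let $\lambda_q=2\cos(\pi/q)$ and $G_q$ the group of Möbius transformations generated by $\sigma(z)=-1/z$, $\tau(z)=z+\lambda_q$. The Farey graph $\mathcal{F}_q$ has vertex set $G_q(\infty)\subset\mathbb{R}\cup\{\infty\}$, and $u\sim v$ (adjacent) iff $\{u,v\}=\{g(0),g(\infty)\}$ for some $g\in G_q$. For integers $b_1,\dots,b_n$ with $s_i(z)=b_i\lambda_q-1/z$, the Rosen continued fraction $[b_1,\dots,b_n]_q$ has value $s_1\circ\dots\circ s_n(\infty)$ and convergents $s_1\circ\dots\circ s_m(\infty)$, $m=1,\dots,n$. *)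

(* Defs.v *)
From HB Require Import structures.
From mathcomp Require Import all_boot all_order all_algebra.
From mathcomp Require Import boolp classical_sets reals topology sequences trigo.

Set Implicit Arguments.
Unset Strict Implicit.
Unset Printing Implicit Defensive.

Import Order.TTheory GRing.Theory Num.Theory.
Local Open Scope classical_set_scope.
Local Open Scope ring_scope.

(* R u {oo}: [None] is the single point at infinity, [Some x] the real x.
   All the Moebius maps below have real coefficients, so they preserve this
   line, and each of them is determined by its restriction to it. *)
Definition eline (R : realType) : Type := option R.
Definition einfty {R : realType} : eline R := None.
Definition epoint {R : realType} (x : R) : eline R := Some x.

Definition lambda (R : realType) (q : nat) : R := 2 * cos (pi / q%:R).

Definition sigma {R : realType} (z : eline R) : eline R :=
  match z with
  | None => epoint 0
  | Some x => if x == 0 then einfty else epoint (- 1 / x)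
  end.

Definition shift {R : realType} (c : R) (z : eline R) : eline R :=
  match z with
  | None => einfty
  | Some x => epoint (c + x)
  end.

Definition tau (R : realType) (q : nat) : eline R -> eline R :=
  shift (lambda R q).

Inductive hecke (R : realType) (q : nat) : (eline R -> eline R) -> Prop :=
| hecke_id : hecke q id
| hecke_sigma : hecke q sigma
| hecke_tau : hecke q (@tau R q)
| hecke_comp f g : hecke q f -> hecke q g -> hecke q (f \o g)
| hecke_inv f g : hecke q f -> cancel f g -> cancel g f -> hecke q g.

Definition farey_vertex (R : realType) (q : nat) : set (eline R) :=
  [set g einfty | g in @hecke R q].

Definition farey_adj {R : realType} (q : nat) (u v : eline R) : Prop :=
  exists2 g, hecke q g & [set u; v] = [set g (epoint 0); g einfty].

(* s_b(z) = b * lambda_q - 1/z *)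
Definition rosen_step {R : realType} (q : nat) (b : int) (z : eline R) :
  eline R := shift (b%:~R * lambda R q) (sigma z).

(* [b_1, ..., b_n]_q = s_{b_1} o ... o s_{b_n} (oo) *)
Definition rosen_value (R : realType) (q : nat) (bs : seq int) : eline R :=
  foldr (rosen_step q) einfty bs.

(* [rosen_convergent R q bs m] is s_{b_1} o ... o s_{b_m} (oo). *)
Definition rosen_convergent (R : realType) (q : nat) (bs : seq int) (m : nat) :
  eline R := rosen_value R q (take m bs).

(* Main.v *)
Require Import Defs.
From mathcomp Require Import all_boot all_order all_algebra.
From mathcomp Require Import boolp classical_sets reals.
From mathcomp Require Import trigo ring.

Set Implicit Arguments.
Unset Strict Implicit.
Unset Printing Implicit Defensive.

(** The crux is that the neighbours of oo are exactly the multiples b lambda_q,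
    i.e. that the stabiliser of oo in G_q contains only powers of tau.  With
    U = tau sigma and c_k = sin (k pi / q), the map M_k = U^k sigma has matrix
    [[c_k, c_(k+1)], [c_(k-1), c_k]] up to scaling, which is nonnegative for
    0 < k < q, and U M_(q-1) = sigma on [0, oo].  Hence any image of the edge
    (0, oo) is, up to sigma and reversal, the image of (0, oo) under a product
    of maps M_k.  By nonnegativity such a product sends oo to oo only if all
    factors are M_1 = tau, and 0 to 0 only if all factors are
    M_(q-1) = sigma tau^-1 sigma.  The theorem then follows by transporting
    each edge of a path back to oo along the group. *)

Import Order.TTheory GRing.Theory Num.Theory.

(** * Homogeneous coordinates on the extended real line *)

Section ProjectiveLine.
Local Open Scope classical_set_scope.
Local Open Scope ring_scope.
Variable R : realType.
Implicit Types (a b c : R) (z : eline R).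

(* [mk_point 0 0] is the junk value oo. *)
Definition mk_point a b : eline R := if b == 0 then einfty else epoint (a / b).

Lemma sigmaK : involutive (@sigma R).
Proof.
case=> [x|] /=; last by rewrite eqxx.
case: eqVneq => [->|x0] //=.
rewrite mulf_eq0 invr_eq0 (negPf x0) oppr_eq0 oner_eq0 /=.
by congr Some; field; rewrite ?x0 ?oppr_eq0 ?oner_eq0.
Qed.

Lemma shiftK c : cancel (shift c) (shift (- c)).
Proof. by case=> //= x; rewrite addKr. Qed.

Lemma shiftNK c : cancel (shift (- c)) (shift c).
Proof. by case=> //= x; rewrite addNKr. Qed.

Lemma shift0 : shift 0 =1 @id (eline R).
Proof. by case=> //= x; rewrite add0r. Qed.

Lemma shiftD a b : shift (a + b) =1 shift a \o shift b.
Proof. by case=> //= x; rewrite addrA. Qed.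

Lemma sigma_mk_point a b :
  (a != 0) || (b != 0) -> sigma (mk_point a b) = mk_point (- b) a.
Proof.
rewrite /mk_point; case: (eqVneq b 0) => [->|b0] /=.
  by rewrite orbF => /negPf ->; rewrite oppr0 mul0r.
move=> _; case: (eqVneq a 0) => [->|a0]; first by rewrite mul0r eqxx.
rewrite mulf_eq0 invr_eq0 (negPf a0) (negPf b0) /=.
by congr Some; field; rewrite a0 b0.
Qed.

Lemma shift_mk_point c a b : shift c (mk_point a b) = mk_point (c * b + a) b.
Proof.
by rewrite /mk_point; case: eqVneq => //= b0; congr Some; field.
Qed.

Lemma mk_pointZ c a b : c != 0 -> mk_point (c * a) (c * b) = mk_point a b.
Proof.
move=> c0; rewrite /mk_point mulf_eq0 (negPf c0) /=.
by case: eqVneq => // b0; congr Some; field; rewrite b0 c0.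
Qed.

Lemma mk_point_infty a b : mk_point a b = einfty -> b = 0.
Proof. by rewrite /mk_point; case: eqVneq. Qed.

Lemma mk_point_zero a b : mk_point a b = epoint 0 -> a = 0.
Proof.
rewrite /mk_point; case: eqVneq => // b0 [] /eqP.
by rewrite mulf_eq0 invr_eq0 (negPf b0) orbF => /eqP.
Qed.

(** The interval [0, oo]; in these coordinates a nonnegative matrix treats its endpoints like any
    other point. *)
Definition nonneg_point z :=
  exists a b, [/\ 0 <= a, 0 <= b, (a != 0) || (b != 0) & z = mk_point a b].

Lemma nonneg_zero : nonneg_point (epoint 0).
Proof.
by exists 0, 1; rewrite lexx ler01 oner_eq0 orbT /mk_point oner_eq0 mul0r.
Qed.

Lemma nonneg_infty : nonneg_point einfty.
Proof.
by exists 1, 0; rewrite lexx ler01 oner_eq0 /mk_point eqxx.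
Qed.

End ProjectiveLine.

(** * The maps M_k on [0, oo] *)

Section Hecke.
Local Open Scope classical_set_scope.
Local Open Scope ring_scope.
Variables (R : realType) (q : nat).
Hypothesis q_gt1 : (1 < q)%N.
Implicit Types (u w x y z : eline R) (k : nat).

Local Notation lam := (@lambda R q).

Let q_pred : (0 < q.-1 < q)%N.
Proof. by case: q q_gt1 => [|[|n]] //= _; rewrite ltnSn. Qed.

Let c k : R := sin (k%:R * (pi / q%:R)).

Let c0 : c 0 = 0.
Proof. by rewrite /c mul0r sin0. Qed.

Let q_neq0 : q%:R != 0 :> R.
Proof. by rewrite pnatr_eq0 -lt0n ltnW. Qed.

Let cq : c q = 0.
Proof. by rewrite /c mulrC divfK // sinpi. Qed.

Let c_gt0 k : (0 < k < q)%N -> 0 < c k.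
Proof.
case/andP=> k0 kq; have q0 : 0 < q%:R :> R by rewrite ltr0n ltnW.
apply: sin_gt0_pi; rewrite mulrA; apply/andP; split.
  by rewrite divr_gt0 // mulr_gt0 ?ltr0n ?pi_gt0.
by rewrite ltr_pdivrMr // mulrC ltr_pM2l ?pi_gt0 // ltr_nat.
Qed.

(** Sum-to-product for sines; it describes left multiplication of the matrix of M_k by that of U,
    [[lambda, -1], [1, 0]]. *)
Let c_rec k : c k.+2 = lam * c k.+1 - c k.
Proof.
rewrite /c /lambda; set t := pi / q%:R.
have -> : k.+2%:R * t = k.+1%:R * t + t by rewrite -[in LHS]natr1; ring.
have -> : k%:R * t = k.+1%:R * t - t by rewrite -[in RHS]natr1; ring.
by rewrite sinD sinB; ring.
Qed.

Let c_ge0 k : (k <= q)%N -> 0 <= c k.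
Proof.
rewrite leq_eqVlt => /predU1P[->|kq]; first by rewrite cq.
by case: k kq => [|k] kq; rewrite ?c0 // ltW // c_gt0.
Qed.

(** This is M_k; the innermost [sigma] makes M_1 equal to [tau]. *)
Definition hecke_rot k z : eline R := iter k (@tau R q \o sigma) (sigma z).

Lemma hecke_rot1 z : hecke_rot 1 z = tau q z.
Proof. by rewrite /hecke_rot /= sigmaK. Qed.

Lemma hecke_rotS k z : hecke_rot k.+1 z = tau q (sigma (hecke_rot k z)).
Proof. by []. Qed.

(** Both diagonal entries of M_(k+1) are c_(k+1) > 0, so a nonzero a keeps the numerator nonzero and
    a nonzero b the denominator. *)
Let hecke_rot_coords k (a b : R) : (k.+1 < q)%N ->
    0 <= a -> 0 <= b -> (a != 0) || (b != 0) ->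
  let num := c k.+1 * a + c k.+2 * b in let den := c k * a + c k.+1 * b in
  [/\ 0 <= num, 0 <= den & (num != 0) || (den != 0)].
Proof.
move=> kq a0 b0 ab.
have ck0 : 0 <= c k by rewrite c_ge0 // ltnW // ltnW.
have ck : 0 < c k.+1 by rewrite c_gt0.
have ck1 := ltW ck; have ck2 : 0 <= c k.+2 by rewrite c_ge0.
split; rewrite ?addr_ge0 ?mulr_ge0 //.
case/orP: ab => [a_neq0|b_neq0]; apply/orP; [left|right].
  have a_gt0 : 0 < a by rewrite lt_def a_neq0.
  by rewrite gt_eqF // ltr_wpDr // ?mulr_ge0 // mulr_gt0.
have b_gt0 : 0 < b by rewrite lt_def b_neq0.
by rewrite gt_eqF // ltr_wpDl // ?mulr_ge0 // mulr_gt0.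
Qed.

(** The bound admits M_q: only the earlier M_1, ..., M_(q-1) must avoid the junk coordinates (0, 0)
    before [sigma] is applied. *)
Let hecke_rot_mk_point k (a b : R) : (k < q)%N ->
    0 <= a -> 0 <= b -> (a != 0) || (b != 0) ->
  hecke_rot k.+1 (mk_point a b) =
  mk_point (c k.+1 * a + c k.+2 * b) (c k * a + c k.+1 * b).
Proof.
move=> kq a0 b0 ab; elim: k kq => [|k IHk] kq.
  have c1 : c 1 != 0 by rewrite gt_eqF // c_gt0.
  rewrite hecke_rot1 /tau shift_mk_point -(mk_pointZ _ _ c1) c_rec c0.
  by congr mk_point; ring.
rewrite hecke_rotS IHk ?(ltnW kq) // sigma_mk_point.
  by rewrite /tau shift_mk_point !c_rec; congr mk_point; ring.
by have [] := hecke_rot_coords kq a0 b0 ab.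
Qed.

Lemma hecke_rot_nonneg k z :
  (0 < k < q)%N -> nonneg_point z -> nonneg_point (hecke_rot k z).
Proof.
case: k => // k kq [a [b [a0 b0 ab ->]]].
have [num0 den0 nz] := hecke_rot_coords kq a0 b0 ab.
by do 2!eexists; split; last exact: hecke_rot_mk_point (ltnW kq) a0 b0 ab.
Qed.

(** As c_q = 0 and c_(q+1) = - c_(q-1), the matrix of M_q is c_(q-1) times that of [sigma]. *)
Lemma hecke_rot_order z : nonneg_point z -> hecke_rot q z = sigma z.
Proof.
have q0 : (0 < q)%N by apply: ltnW.
case=> [a [b [a0 b0 ab ->]]]; rewrite -[in LHS](prednK q0).
rewrite hecke_rot_mk_point ?prednK // sigma_mk_point //.
have cp : 0 < c q.-1 by rewrite c_gt0.
have -> : c q.+1 = - c q.-1.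
  by rewrite -[q in LHS](prednK q0) c_rec prednK // cq mulr0 sub0r.
rewrite cq -[RHS](mk_pointZ (c := c q.-1)) ?gt_eqF //.
by congr mk_point; ring.
Qed.

(** The denominator c_(k-1) a + c_k b has nonnegative terms and c_k > 0, so its vanishing forces b =
    0 and then c_(k-1) = 0. *)
Lemma hecke_rot_eq_infty k z : (0 < k < q)%N -> nonneg_point z ->
  hecke_rot k z = einfty -> k = 1%N /\ z = einfty.
Proof.
case: k => // k kq [a [b [a0 b0 ab ->]]].
have ck : 0 < c k.+1 by rewrite c_gt0.
have ck0 : 0 <= c k by rewrite c_ge0 // ltnW // ltnW.
rewrite hecke_rot_mk_point // 1?ltnW // => /mk_point_infty/eqP.
rewrite paddr_eq0 ?mulr_ge0 ?(ltW ck) // !mulf_eq0 (gt_eqF ck) /=.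
case/andP=> cka /eqP b_eq0; move: ab; rewrite b_eq0 eqxx orbF => a_neq0.
split; last by rewrite /mk_point eqxx.
case: k cka kq {ck ck0} => // k; rewrite (negPf a_neq0) orbF => /eqP ck kq.
by have := @c_gt0 k.+1; rewrite ck ltxx /= => /(_ (ltnW kq)).
Qed.

(** The same argument for the numerator c_k a + c_(k+1) b. *)
Lemma hecke_rot_eq_zero k z : (0 < k < q)%N -> nonneg_point z ->
  hecke_rot k z = epoint 0 -> k.+1 = q /\ z = epoint 0.
Proof.
case: k => // k kq [a [b [a0 b0 ab ->]]].
have ck : 0 < c k.+1 by rewrite c_gt0.
have ck2 : 0 <= c k.+2 by rewrite c_ge0.
rewrite hecke_rot_mk_point // 1?ltnW // => /mk_point_zero/eqP.
rewrite paddr_eq0 ?mulr_ge0 ?(ltW ck) // !mulf_eq0 (gt_eqF ck) /=.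
case/andP=> /eqP a_eq0; move: ab; rewrite a_eq0 eqxx /= => b_neq0.
rewrite (negPf b_neq0) orbF => /eqP ck20.
split; last by rewrite /mk_point (negPf b_neq0) mul0r.
move: kq => /=; rewrite leq_eqVlt => /predU1P[//|kq].
by have := @c_gt0 k.+2; rewrite ck20 ltxx kq => /(_ isT).
Qed.

(** * Edges, and those ending at 0 or oo *)

(* The oriented images of the edge (0, oo) that lie in [0, oo]. *)
Inductive pos_edge : eline R -> eline R -> Prop :=
| pos_edge_base : pos_edge (epoint 0) einfty
| pos_edge_flip : pos_edge einfty (epoint 0)
| pos_edge_rot k x y : (0 < k < q)%N -> pos_edge x y ->
    pos_edge (hecke_rot k x) (hecke_rot k y).

(** An edge lies on one side of 0 and oo, and [sigma] exchanges the two sides. *)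
Definition edge x y := pos_edge x y \/ pos_edge (sigma x) (sigma y).

Lemma pos_edge_sym x y : pos_edge x y -> pos_edge y x.
Proof.
elim=> [||k {}x {}y kq _ IH]; [exact: pos_edge_flip|exact: pos_edge_base|].
exact: pos_edge_rot.
Qed.

Lemma edge_sym x y : edge x y -> edge y x.
Proof. by case=> /pos_edge_sym; [left|right]. Qed.

Lemma pos_edge_nonneg x y : pos_edge x y -> nonneg_point x /\ nonneg_point y.
Proof.
elim=> [||k {}x {}y kq _ [hx hy]]; last by split; apply: hecke_rot_nonneg.
- by split; [exact: nonneg_zero|exact: nonneg_infty].
- by split; [exact: nonneg_infty|exact: nonneg_zero].
Qed.

Lemma pos_edge_infty x y : pos_edge x y -> y = einfty ->
  exists r : nat, x = epoint (r%:R * lam).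
Proof.
elim=> [_|//|k {}x {}y kq xy IH].
  by exists 0%N; rewrite mul0r.
have [_ hy] := pos_edge_nonneg xy.
case/(hecke_rot_eq_infty kq hy) => -> /IH[r ->].
exists r.+1; rewrite hecke_rot1 /= /epoint.
by congr Some; rewrite -[r.+1%:R]natr1; ring.
Qed.

Lemma pos_edge_zero x y : pos_edge x y -> y = epoint 0 ->
  exists r : nat, sigma x = epoint (- r%:R * lam).
Proof.
elim=> [//|_|k {}x {}y kq xy IH].
  by exists 0%N; rewrite oppr0 mul0r.
have [hx hy] := pos_edge_nonneg xy.
case/(hecke_rot_eq_zero kq hy) => kq1 /IH[r hr].
(* U M_(q-1) = sigma, so each factor M_(q-1) subtracts lambda from [sigma x]. *)
exists r.+1; have := hecke_rot_order hx.
rewrite -[q in hecke_rot q _]kq1 hecke_rotS hr.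
move=> /(congr1 (shift (- lam))); rewrite /tau shiftK => ->.
by rewrite /= /epoint; congr Some; rewrite -[r.+1%:R]natr1; ring.
Qed.

(** The positive side gives b >= 0; the other side gives b <= 0, through edges at 0 = sigma(oo). *)
Lemma edge_infty x : edge x einfty -> exists b : int, x = epoint (b%:~R * lam).
Proof.
case=> [/pos_edge_infty[//|r ->]|/pos_edge_zero[//|r]]; first by exists r%:Z.
by rewrite sigmaK => ->; exists (- r%:Z); rewrite mulrNz.
Qed.

(** * Invariance of edges under G_q *)

Lemma edge_sigma x y : edge x y <-> edge (sigma x) (sigma y).
Proof. by rewrite /edge !sigmaK; tauto. Qed.

(** U turns an outer factor M_k into M_(k+1), which stays on the positive side until k + 1 = q,
    where it becomes [sigma]. *)
Lemma edge_tau_pos x y : pos_edge x y -> edge (tau q (sigma x)) (tau q (sigma y)).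
Proof.
have zero_tau : pos_edge (tau q (epoint 0)) einfty.
  have := @pos_edge_rot 1 _ _ q_gt1 pos_edge_base.
  by rewrite !hecke_rot1.
case=> [||k {}x {}y kq xy].
- by left; rewrite /= eqxx; apply: pos_edge_sym.
- by left; rewrite /= eqxx.
- have [hx hy] := pos_edge_nonneg xy; rewrite -!hecke_rotS.
  have := kq; case/andP=> k0; rewrite leq_eqVlt => /predU1P[->|kq1].
    by right; rewrite !hecke_rot_order // !sigmaK.
  by left; apply: pos_edge_rot.
Qed.

Lemma edge_tau x y : edge x y <-> edge (tau q x) (tau q y).
Proof.
(* If the translated edge is on the negative side, U M_(q-1) = sigma shows that the original is
   too. *)
have inv u w : pos_edge (sigma (tau q u)) (sigma (tau q w)) -> edge u w.
  move=> uw; right; have [hu hw] := pos_edge_nonneg uw.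
  have back z : nonneg_point (sigma (tau q z)) ->
      sigma z = hecke_rot q.-1 (sigma (tau q z)).
    move=> /hecke_rot_order; rewrite sigmaK -[q in hecke_rot q _]prednK.
      by rewrite hecke_rotS => /(can_inj (shiftK _)) {1}<-; rewrite sigmaK.
    exact: ltnW.
  by rewrite (back u) // (back w) //; apply: pos_edge_rot.
split=> [[xy|xy]|[]]; last exact: inv.
- by left; rewrite -!hecke_rot1; apply: pos_edge_rot.
- by have := edge_tau_pos xy; rewrite !sigmaK.
move Eu : (tau q x) => u; move Ew : (tau q y) => w uw.
(* [sigma] reverses the base edge, so [inv] covers both orientations. M_1 = tau cancels; for larger
   indices M_(k+1) = tau sigma M_k leaves a negative edge. *)
case: uw Eu Ew => [||[//|[|k]] {}u {}w kq uw] Eu Ew.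
- by apply: inv; rewrite Eu Ew /= eqxx; exact: pos_edge_flip.
- by apply: inv; rewrite Eu Ew /= eqxx; exact: pos_edge_base.
- move: Eu Ew; rewrite !hecke_rot1.
  by move=> /(can_inj (shiftK _)) -> /(can_inj (shiftK _)) ->; left.
move: Eu Ew; rewrite !(hecke_rotS k.+1).
move=> /(can_inj (shiftK _)) -> /(can_inj (shiftK _)) ->.
by right; rewrite !sigmaK; apply: pos_edge_rot; rewrite //= ltnW.
Qed.

(** The equivalence, rather than one implication, carries the induction through inverses. *)
Lemma hecke_edge g x y : hecke q g -> edge x y <-> edge (g x) (g y).
Proof.
move=> hg; elim: hg x y => {g} [||| f g _ IHf _ IHg | f g _ IHf fK gK] x y //.
- exact: edge_sigma.
- exact: edge_tau.
- by rewrite IHg IHf.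
- by rewrite (IHf (g x)) !gK.
Qed.

(** * Farey neighbours of oo and their translates *)

Lemma farey_adj_edge u w : farey_adj q u w -> edge u w.
Proof.
case=> g hg E; have gE : edge (g (epoint 0)) (g einfty).
  by apply: (hecke_edge _ _ hg).1; left; exact: pos_edge_base.
(* All four memberships are extracted, so that if u = w the edge collapses to that one point as
   well. *)
have := congr1 (fun A => A (g (epoint 0))) E.
have := congr1 (fun A => A (g einfty)) E.
have := congr1 (fun A => A u) E; have := congr1 (fun A => A w) E => /=.
move: (g (epoint 0)) (g einfty) gE {E} => x y xy.
rewrite !propeqE => -[hw _] [hu _] [_ hy] [_ hx].
have {}hw : w = x \/ w = y by apply: hw; right.
have {}hu : u = x \/ u = y by apply: hu; left.
have {}hx : x = u \/ x = w by apply: hx; left.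
have {}hy : y = u \/ y = w by apply: hy; right.
case: hu hw hx hy => -> [] -> //.
- by case=> _ [] e; rewrite e in xy *.
- by move=> _ _; apply: edge_sym.
- by move=> [] e _; rewrite e in xy *.
Qed.

Lemma hecke_invertible g : hecke q g ->
  exists f : eline R -> eline R, [/\ hecke q f, cancel g f & cancel f g].
Proof.
elim=> {g} [||| f g hf [f' [hf' fK f'K]] hg [g' [hg' gK g'K]]
           | f g hf _ fK gK].
- by exists id; split=> //; exact: hecke_id.
- by exists sigma; split; [exact: hecke_sigma|exact: sigmaK|exact: sigmaK].
- exists (shift (- lam)); split; [|exact: shiftK|exact: shiftNK].
  by apply: hecke_inv (hecke_tau R q) _ _; [exact: shiftK|exact: shiftNK].
- exists (g' \o f'); split; first exact: hecke_comp.
  + exact: can_comp.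
  + exact: can_comp.
- by exists f.
Qed.

Lemma hecke_shift (b : int) : hecke q (shift (b%:~R * lam)).
Proof.
have pos (n : nat) : hecke q (shift (n%:R * lam)).
  elim: n => [|n IHn].
    by rewrite mul0r (funext (@shift0 R)); exact: hecke_id.
  rewrite -natr1 mulrDl mul1r (funext (shiftD _ _)).
  exact: hecke_comp IHn (hecke_tau R q).
case: b => n; first exact: pos.
rewrite NegzE mulrNz mulNr.
by apply: hecke_inv (pos n.+1) _ _; [exact: shiftK|exact: shiftNK].
Qed.

Lemma hecke_rosen_step b : hecke q (@rosen_step R q b).
Proof. exact: hecke_comp (hecke_shift b) (hecke_sigma R q). Qed.

Lemma hecke_farey_adj g u w :
  hecke q g -> farey_adj q u w -> farey_adj q (g u) (g w).
Proof.
move=> hg [f hf E]; exists (g \o f); first exact: hecke_comp.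
by rewrite -!(image_set1 g) -!image_setU E !image_setU !image_set1.
Qed.

Lemma farey_adj_infty w :
  farey_adj q einfty w <-> exists b, w = rosen_step q b einfty.
Proof.
split=> [/farey_adj_edge/edge_sym/edge_infty[b ->]|[b ->]].
  by exists b; rewrite /rosen_step /= addr0.
exists (shift (b%:~R * lam)); first exact: hecke_shift.
by rewrite setUC.
Qed.

Lemma hecke_farey_adj_infty g u : hecke q g ->
  farey_adj q (g einfty) u <-> exists b, u = g (rosen_step q b einfty).
Proof.
move=> hg; have [f [hf gK fK]] := hecke_invertible hg.
split=> [/(hecke_farey_adj hf)|[b ->]].
  by rewrite gK => /farey_adj_infty[b fu]; exists b; rewrite -fu fK.
by apply: hecke_farey_adj => //; apply/farey_adj_infty; exists b.
Qed.

(** Generalised over g for the induction: g is the product of the steps already taken, and the tail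
    of the path uses g \o s_b. *)
Lemma path_farey_convergents g (v : seq (eline R)) : hecke q g ->
  path (fun u w => `[< farey_adj q u w >]) (g einfty) v <->
  exists2 b : seq int, size b = size v &
    forall i, (i < size v)%N -> nth einfty v i = g (rosen_convergent R q b i.+1).
Proof.
elim: v g => [|u v IHv] g hg; first by split=> // _; exists [::].
have step b : hecke q (g \o rosen_step q b).
  exact: hecke_comp hg (hecke_rosen_step b).
split=> [/= /andP[/asboolP/(hecke_farey_adj_infty _ hg)[b0 ->]]|].
  case/(IHv _ (step b0)) => b sb hb; exists (b0 :: b); first by rewrite /= sb.
  by case=> [|i] /=; [rewrite /rosen_convergent /= take0|exact: hb].
case=> [[//|b0 b] [sb] hb]; have := hb 0%N isT.
rewrite /rosen_convergent /= take0 => -> /=; apply/andP; split.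
  by apply/asboolP/(hecke_farey_adj_infty _ hg); exists b0.
apply/(IHv _ (step b0)); exists b => // i iv.
exact: (hb i.+1).
Qed.

End Hecke.

Theorem theorem4 (R : realType) (q : nat) (hq : 3 <= q)
    (y : eline R) (hy : farey_vertex q y)
    (n : nat) (hn : 0 < n) (v : n.-tuple (eline R))
    (hv : forall i : 'I_n, farey_vertex q (tnth v i))
    (hvn : last einfty v = y) :
  (exists b : n.-tuple int,
      rosen_value R q b = y /\
      forall i : 'I_n, tnth v i = rosen_convergent R q b i.+1)
  <-> path (fun u w => `[< farey_adj q u w >]) einfty v.
Proof.
have P := @path_farey_convergents R q (ltnW hq) id v (hecke_id R q).
split=> [[b [_ hb]]|/P[b sb hb]].
  apply/P; exists b => [|i]; first by rewrite !size_tuple.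
  rewrite size_tuple => i_n.
  by have := hb (Ordinal i_n); rewrite (tnth_nth einfty).
have sb' : size b == n by rewrite sb size_tuple.
exists (Tuple sb'); split=> [|i]; last first.
  by rewrite (tnth_nth einfty) hb ?size_tuple.
(* The value is the n-th convergent, hence the last vertex; n > 0 ensures that this vertex
   exists. *)
rewrite -hvn -nth_last hb ?size_tuple ?prednK // /rosen_convergent.
by rewrite -{3}(eqP sb') take_size.
Qed.
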